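(* Let $m\ge 0$ be an integer. Then, as formal power series in $q$ with coefficients polynomials in $x$, $$\sum_{\lambda\in\mathcal{A}_m} x^{l_a(\lambda)}q^{|\lambda|}=\sum_{\mu\in\mathcal{B}_m} x^{l_o(\mu)}q^{|\mu|}=\frac{(-xq;q^2)_{\infty}(q^{2m+2};q^{2m+2})_{\infty}}{(q^2;q^2)_{\infty}(x^2q^2;q^4)_{\infty}},$$ where $\mathcal{A}_m$ is the set of all partitions (including the empty one) in which each part appears at most $2m+1$ times, and $\mathcal{B}_m$ is the set of all partitions in which each even part appears at most $m$ times.
   Context: For a partition $\lambda=(\lambda_1\ge\lambda_2\ge\cdots\ge\lambda_r>0)$: $|\lambda|=\sum_i\lambda_i$; $l_a(\lambda)=\lambda_1-\lambda_2+\lambda_3-\cdots$ is the alternating sum; $l_o(\lambda)$ is the number of odd parts counted with multiplicity. $(a;q)_\infty=\prod_{i\ge0}(1-aq^i)$. *)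

(* Defs.v *)
From HB Require Import structures.
From mathcomp Require Import all_boot all_order all_algebra.
From mathcomp Require Import zify.
From mathcomp Require Import boolp classical_sets functions cardinality fsbigop.

Set Implicit Arguments.
Unset Strict Implicit.
Unset Printing Implicit Defensive.

Import Order.TTheory GRing.Theory Num.Theory.

Local Open Scope classical_set_scope.
Local Open Scope ring_scope.

(* R[[q]]. A record rather than a bare [nat -> R], since functions already carry
   the pointwise ring structure. *)
Record fps (R : Type) := Fps { fcoef : nat -> R }.

HB.instance Definition _ (R : Type) := gen_eqMixin (fps R).
HB.instance Definition _ (R : Type) := gen_choiceMixin (fps R).

Lemma fpsP (R : Type) (f g : fps R) : (forall n, fcoef f n = fcoef g n) -> f = g.
Proof. by case: f g => [f] [g] /= /funext ->. Qed.

Section FpsRing.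
Variable R : comNzRingType.
Implicit Types f g h : fps R.

Definition fps_zero : fps R := Fps (fun=> 0).
Definition fps_opp f : fps R := Fps (fun n => - fcoef f n).
Definition fps_add f g : fps R := Fps (fun n => fcoef f n + fcoef g n).
Definition fps_one : fps R := Fps (fun n => (n == 0%N)%:R).
Definition fps_mul f g : fps R :=
  Fps (fun n => \sum_(i < n.+1) fcoef f i * fcoef g (n - i)).

Let trunc N f : {poly R} := \poly_(i < N.+1) fcoef f i.

Let coef_trunc N f n : (n <= N)%N -> (trunc N f)`_n = fcoef f n.
Proof. by move=> nN; rewrite coef_poly ltnS nN. Qed.

Let eq_coefM (p p' q q' : {poly R}) n :
  (forall i, (i <= n)%N -> p`_i = p'`_i) ->
  (forall i, (i <= n)%N -> q`_i = q'`_i) -> (p * q)`_n = (p' * q')`_n.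
Proof.
move=> ep eq; rewrite !coefM; apply: eq_bigr => i _.
by rewrite ep ?eq ?leq_subr // -ltnS.
Qed.

Let fps_mulE N f g n : (n <= N)%N ->
  fcoef (fps_mul f g) n = (trunc N f * trunc N g)`_n.
Proof.
move=> nN; rewrite coefM /=; apply: eq_bigr => i _.
rewrite !coef_trunc //; first by rewrite (leq_trans _ nN)// leq_subr.
by rewrite (leq_trans _ nN)// -ltnS.
Qed.

Fact fps_addA : associative fps_add.
Proof. by move=> f g h; apply: fpsP => n /=; rewrite addrA. Qed.
Fact fps_addC : commutative fps_add.
Proof. by move=> f g; apply: fpsP => n /=; rewrite addrC. Qed.
Fact fps_add0 : left_id fps_zero fps_add.
Proof. by move=> f; apply: fpsP => n /=; rewrite add0r. Qed.
Fact fps_addN : left_inverse fps_zero fps_opp fps_add.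
Proof. by move=> f; apply: fpsP => n /=; rewrite addNr. Qed.

HB.instance Definition _ :=
  GRing.isZmodule.Build (fps R) fps_addA fps_addC fps_add0 fps_addN.

Fact fps_mulA : associative fps_mul.
Proof.
move=> f g h; apply: fpsP => n; rewrite !(@fps_mulE n) //.
rewrite (@eq_coefM _ (trunc n f) _ (trunc n g * trunc n h)) //; last first.
  by move=> i ni; rewrite coef_trunc // (@fps_mulE n).
rewrite mulrA; apply: eq_coefM => // i ni.
by rewrite coef_trunc // (@fps_mulE n).
Qed.
Fact fps_mulC : commutative fps_mul.
Proof. by move=> f g; apply: fpsP => n; rewrite !(@fps_mulE n) // mulrC. Qed.
Fact fps_mul1 : left_id fps_one fps_mul.
Proof.
move=> f; apply: fpsP => n /=; rewrite big_ord_recl /= subn0 mul1r.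
by rewrite big1 ?addr0 // => i _; rewrite mul0r.
Qed.
Fact fps_mulDl : left_distributive fps_mul fps_add.
Proof.
move=> f g h; apply: fpsP => n /=; rewrite -big_split /=.
by apply: eq_bigr => i _; rewrite mulrDl.
Qed.
Fact fps_one_neq0 : fps_one != 0.
Proof.
by apply/eqP => /(congr1 (fun f => fcoef f 0)) /eqP /=; rewrite oner_eq0.
Qed.

HB.instance Definition _ := GRing.Zmodule_isComNzRing.Build (fps R)
  fps_mulA fps_mulC fps_mul1 fps_mulDl fps_one_neq0.

Definition fps_unit : pred (fps R) := fun f => `[< exists g, g * f = 1 >].
Definition fps_inv f : fps R := xget f [set g | g * f = 1].

Fact fps_mulVf : {in fps_unit, left_inverse 1 fps_inv *%R}.
Proof. by move=> f /asboolP; exact: xgetPex. Qed.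
Fact fps_unitPl f g : g * f = 1 -> fps_unit f.
Proof. by move=> gf; apply/asboolP; exists g. Qed.
Fact fps_inv_out : {in [predC fps_unit], fps_inv =1 id}.
Proof.
by move=> f /asboolP nf; apply: xgetPN => g /= gf; apply: nf; exists g.
Qed.

HB.instance Definition _ := GRing.ComNzRing_hasMulInverse.Build (fps R)
  fps_mulVf fps_unitPl fps_inv_out.

Lemma fcoef0 n : fcoef (0 : fps R) n = 0. Proof. by []. Qed.
Lemma fcoef1 n : fcoef (1 : fps R) n = (n == 0%N)%:R. Proof. by []. Qed.
Lemma fcoefD f g n : fcoef (f + g) n = fcoef f n + fcoef g n.
Proof. by []. Qed.
Lemma fcoefN f n : fcoef (- f) n = - fcoef f n. Proof. by []. Qed.
Lemma fcoefM f g n :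
  fcoef (f * g) n = \sum_(i < n.+1) fcoef f i * fcoef g (n - i).
Proof. by []. Qed.
Lemma fcoef_sum (I : Type) (r : seq I) (P : pred I) (F : I -> fps R) n :
  fcoef (\sum_(i <- r | P i) F i) n = \sum_(i <- r | P i) fcoef (F i) n.
Proof. by elim/big_rec2: _ => // i x f _ <-. Qed.

Definition fpsC (c : R) : fps R := Fps (fun n => if n == 0%N then c else 0).
Definition fpsX : fps R := Fps (fun n => (n == 1%N)%:R).

Definition is_fps_lim (u : nat -> fps R) f :=
  forall k, exists N, forall n, (N <= n)%N -> fcoef (u n) k = fcoef f k.
Definition fps_lim (u : nat -> fps R) : fps R := xget 0 [set f | is_fps_lim u f].

Lemma fps_lim_eq u f : is_fps_lim u f -> fps_lim u = f.
Proof.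
move=> uf; apply: xget_unique => // g ug; apply: fpsP => k.
have [N fN] := uf k; have [M gM] := ug k.
by rewrite -(fN (maxn N M)) ?leq_maxl // (gM (maxn N M)) ?leq_maxr.
Qed.

(* (a; b)_oo; the limit exists as soon as b has constant term 0, see
   [qpoch_cvg]. *)
Definition qpoch (a b : fps R) : fps R :=
  fps_lim (fun n => \prod_(i < n) (1 - a * b ^+ i)).

(* Coefficientwise sum of a family of series. The library's [\sum_(i \in A)]
   is 0 when infinitely many terms are nonzero; for the family of all
   partitions this does not happen, see [finite_partn_of]. *)
Definition fps_sum (I : choiceType) (A : set I) (F : I -> fps R) : fps R :=
  Fps (fun n => \sum_(i \in A) fcoef (F i) n).

Lemma fcoefX_lt f n k : fcoef f 0 = 0 -> (k < n)%N -> fcoef (f ^+ n) k = 0.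
Proof.
move=> f0; elim: n k => // n IHn k kn; rewrite exprS fcoefM big1 // => -[i /= ik] _.
case: i ik => [|i] ik; first by rewrite f0 mul0r.
by rewrite IHn ?mulr0 //; lia.
Qed.

Lemma fps_unit1 f : fcoef f 0 = 1 -> f \is a GRing.unit.
Proof.
move=> f1; pose g := 1 - f.
have g0 : fcoef g 0 = 0 by rewrite fcoefD fcoefN fcoef1 f1 subrr.
pose h : fps R := Fps (fun k => fcoef (\sum_(i < k.+1) g ^+ i) k).
apply/asboolP; exists h; apply: fpsP => n.
have -> : fcoef (h * f) n = fcoef ((\sum_(i < n.+1) g ^+ i) * f) n.
  rewrite !fcoefM; apply: eq_bigr => -[j /= jn] _; congr (_ * _).
  rewrite !fcoef_sum -(big_mkord xpredT (fun i => fcoef (g ^+ i) j)).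
  rewrite -(big_mkord xpredT (fun i => fcoef (g ^+ i) j)).
  rewrite (@big_cat_nat _ _ _ j.+1 0 n.+1) //= [X in _ + X]big_nat.
  rewrite [X in _ + X]big1 ?addr0 // => i /andP[ji _].
  exact: fcoefX_lt.
have -> : (\sum_(i < n.+1) g ^+ i) * f = 1 - g ^+ n.+1.
  have gf : 1 - g = f by rewrite /g opprB addrC subrK.
  by rewrite -[RHS]opprB subrX1 -mulNr opprB gf mulrC.
by rewrite fcoefD fcoefN fcoefX_lt // subr0.
Qed.

Lemma qpoch_cvg (a b : fps R) : fcoef b 0 = 0 ->
  is_fps_lim (fun n => \prod_(i < n) (1 - a * b ^+ i)) (qpoch a b).
Proof.
move=> b0; set u := (X in is_fps_lim X _).
have uS k n : (k < n)%N -> fcoef (u n) k = fcoef (u k.+1) k.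
  elim: n => // n IHn; rewrite ltnS leq_eqVlt => /predU1P[-> //|kn].
  have -> : u n.+1 = u n * (1 - a * b ^+ n) by rewrite /u big_ord_recr.
  rewrite -IHn // mulrBr mulr1 fcoefD fcoefN mulrA fcoefM.
  rewrite [X in _ - X]big1 ?subr0 // => -[i /= ik] _.
  by rewrite (fcoefX_lt b0) ?mulr0 //; lia.
have uf : is_fps_lim u (Fps (fun k => fcoef (u k.+1) k)).
  by move=> k; exists k.+1 => n /uS.
by rewrite /qpoch -/u (fps_lim_eq uf).
Qed.

End FpsRing.

Arguments fpsX {R}.

Definition is_partn (s : seq nat) := sorted geq s && (0%N \notin s).

Record partn := Partn { parts :> seq nat; partsP : is_partn parts }.

HB.instance Definition _ := [isSub for parts].
HB.instance Definition _ := [Choice of partn by <:].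

Definition alt_sum (s : seq nat) : int :=
  \sum_(i < size s) (-1) ^+ i * (nth 0%N s i)%:Z.

(* [absz] only casts to nat, see [alt_sum_ge0]. *)
Definition l_a (la : partn) : nat := `|alt_sum la|%N.
Definition l_o (la : partn) : nat := count odd la.

Definition A_ (m : nat) : set partn :=
  [set la | forall i, (count_mem i (parts la) <= 2 * m + 1)%N].
Definition B_ (m : nat) : set partn :=
  [set mu | forall i, ~~ odd i -> (count_mem i (parts mu) <= m)%N].

Lemma alt_sum_ge0 (la : partn) : 0 <= alt_sum la.
Proof.
case: la => s /= /andP[+ _]; case: s => [|a s /=]; first by rewrite /alt_sum big_ord0.
suff H : path geq a s -> 0 <= alt_sum (a :: s) <= a%:Z by move=> /H /andP[].
elim: s a => [|b s IHs] a.
  by move=> _; rewrite /alt_sum big_ord_recl big_ord0 /=; lia.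
have -> : alt_sum [:: a, b & s] = a%:Z - alt_sum (b :: s).
  rewrite /alt_sum big_ord_recl expr0 mul1r -sumrN; congr (_ + _).
  by apply: eq_bigr => i _; rewrite lift0 exprS mulN1r mulNr.
by move=> /= /andP[ba /IHs]; lia.
Qed.

Lemma finite_partn_of n : finite_set [set la : partn | sumn la = n].
Proof.
pose nil_partn : partn := @Partn [::] isT.
pose f (t : {bseq n of 'I_n.+1}) : partn :=
  insubd nil_partn (map (@nat_of_ord n.+1) t).
apply: (@sub_finite_set _ _ (f @` setT)); last exact: finite_image.
move=> la /= lan.
have lan0 : forall i, i \in parts la -> (0 < i)%N.
  move=> i ila; rewrite lt0n; apply: contraTneq ila => ->.
  by have /andP[] := partsP la.
have le_n i : i \in parts la -> (i <= n)%N.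
  rewrite -lan; elim: (parts la) => //= a s IHs; rewrite inE => /predU1P[->|/IHs]; lia.
have size_n : (size [seq inord i : 'I_n.+1 | i <- parts la] <= n)%N.
  rewrite size_map; move: lan0; rewrite -lan; elim: (parts la) => //= a s IHs H.
  have := H a (mem_head _ _).
  have : (size s <= sumn s)%N by apply: IHs => i si; apply: H; rewrite inE si orbT.
  lia.
exists (Bseq size_n) => //; apply: val_inj => /=.
rewrite /f /= -map_comp map_id_in => [|i /le_n ni /=]; last by rewrite inordK.
by rewrite insubdK //; exact: (partsP la).
Qed.

(* Main.v *)
Require Import Defs.
From mathcomp Require Import all_boot all_order all_algebra.
From mathcomp Require Import zify ring.
From mathcomp Require Import boolp classical_sets functions cardinality fsbigop.
Import GRing.Theory.
Local Open Scope ring_scope.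

(** Over all partitions, [l_a] and [l_o] have the same generating function
    prod_j 1 / (1 - x^[j odd] q^j): a partition with exactly r parts is one with
    at most r parts with a column of length r prepended, which adds [r odd] to
    [l_a]; a partition with largest part r is one with parts at most r with r
    inserted, which adds [r odd] to [l_o]. Inserting 2m+2 copies of i does not
    change [l_a], and inserting m+1 copies of 2i does not change [l_o]; both add
    (2m+2)i to the size. Hence restricting to A_m, respectively B_m, multiplies
    either generating function by the same prod_i (1 - q^((2m+2)i)). *)

(** * Coefficients, limits and units of formal power series *)

Section FpsExtra.
Set Implicit Arguments.
Unset Strict Implicit.
Variable R : comNzRingType.
Implicit Types (c : R) (f g : fps R).

Lemma fcoef_fpsCM c f n : fcoef (fpsC c * f) n = c * fcoef f n.
Proof.
by rewrite fcoefM big_ord_recl subn0 big1 ?addr0 // => i _; rewrite /= mul0r.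
Qed.

Lemma fpsC_exp c a : fpsC c ^+ a = fpsC (c ^+ a).
Proof.
elim: a => [|a IHa]; apply: fpsP => n; first by rewrite !expr0 /=; case: eqP.
by rewrite !exprS IHa fcoef_fpsCM /=; case: eqP; rewrite ?mulr0.
Qed.

Lemma fcoef_fpsXM f n :
  fcoef (fpsX * f) n = if n is n'.+1 then fcoef f n' else 0.
Proof.
rewrite fcoefM; case: n => [|n]; first by rewrite big_ord1 mul0r.
rewrite 2!big_ord_recl big1 => [|i _]; last by rewrite /= mul0r.
by rewrite /= mul0r mul1r add0r addr0 subSS subn0.
Qed.

Lemma fcoef_fpsXnM b f n :
  fcoef (fpsX ^+ b * f) n = if (b <= n)%N then fcoef f (n - b) else 0.
Proof.
elim: b n => [|b IHb] n; first by rewrite expr0 mul1r subn0.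
by rewrite exprS -mulrA fcoef_fpsXM; case: n => // n; rewrite IHb subSS.
Qed.

Lemma fcoef_monomial c a b n :
  fcoef (fpsC c ^+ a * fpsX ^+ b) n = if n == b then c ^+ a else 0.
Proof.
rewrite fpsC_exp fcoef_fpsCM -[fpsX ^+ b]mulr1 fcoef_fpsXnM fcoef1 subn_eq0.
by rewrite eqn_leq; case: (leqP b n); case: (leqP n b); rewrite ?mulr0 ?mulr1.
Qed.

Lemma fcoef_fpsXn0 b : (0 < b)%N -> fcoef (fpsX ^+ b : fps R) 0 = 0.
Proof. by rewrite -[fpsX ^+ _]mulr1 fcoef_fpsXnM leqn0; case: b. Qed.

(** The [k]-th coefficient of a product involves only coefficients up to [k] of the factors, so
    finitely many thresholds can be merged into one. *)
Lemma is_fps_limM (u v : nat -> fps R) f g :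
  is_fps_lim u f -> is_fps_lim v g -> is_fps_lim (fun n => u n * v n) (f * g).
Proof.
move=> uf vg k.
have lim_le (w : nat -> fps R) h : is_fps_lim w h ->
    exists N, forall n i, (N <= n)%N -> (i <= k)%N -> fcoef (w n) i = fcoef h i.
  move=> wh; elim: k => [|j [N HN]].
    by have [N HN] := wh 0; exists N => n i Nn; rewrite leqn0 => /eqP ->; apply: HN.
  have [M HM] := wh j.+1; exists (maxn N M) => n i; rewrite geq_max => /andP[Nn Mn].
  by rewrite leq_eqVlt => /predU1P[->|]; [apply: HM | apply: HN].
have [N HN] := lim_le _ _ uf; have [M HM] := lim_le _ _ vg.
exists (maxn N M) => n; rewrite geq_max => /andP[Nn Mn].
by rewrite !fcoefM; apply: eq_bigr => -[i /= ik] _; rewrite HN ?HM //; lia.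
Qed.

Lemma is_fps_lim_unique (u : nat -> fps R) f g :
  is_fps_lim u f -> is_fps_lim u g -> f = g.
Proof. by move=> /fps_lim_eq <- /fps_lim_eq. Qed.

Lemma is_fps_lim_cst f : is_fps_lim (fun=> f) f.
Proof. by move=> k; exists 0. Qed.

(** Even truncations allow the factors of an Euler product to be taken in pairs, one of odd and one
    of even index. *)
Lemma is_fps_lim_double (u : nat -> fps R) f :
  is_fps_lim u f -> is_fps_lim (fun n => u n.*2) f.
Proof. by move=> uf k; have [N HN] := uf k; exists N => n Nn; apply: HN; lia. Qed.

(** Every finite product has constant term 1, and the limit inherits it. *)
Lemma qpoch_unit (a b : fps R) :
  fcoef a 0 = 0 -> fcoef b 0 = 0 -> qpoch a b \is a GRing.unit.
Proof.
move=> a0 b0; apply: fps_unit1.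
have [N /(_ N (leqnn N)) <-] := qpoch_cvg a b0 0.
elim: N => [|N IHN]; first by rewrite big_ord0.
by rewrite big_ord_recr fcoefM big_ord1 IHN mul1r fcoefD fcoefN fcoefM big_ord1
   a0 mul0r subr0.
Qed.

End FpsExtra.

(** * Partitions as multisets: inserting equal parts, prepending a column *)

Section Partitions.
Set Implicit Arguments.
Unset Strict Implicit.
(* MathComp has another [partn], the pi-part of a number. *)
Local Notation partn := Defs.partn.
Implicit Types (la mu : partn) (s : seq nat).
Local Open Scope nat_scope.

Lemma partn_gt0 la i : i \in parts la -> 0 < i.
Proof.
by move=> ila; rewrite lt0n; apply: contraTneq ila => ->; case/andP: (partsP la).
Qed.

Lemma perm_partn_inj la mu : perm_eq la mu -> la = mu.
Proof.
move=> pe; apply: val_inj => /=.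
have /andP[sl _] := partsP la; have /andP[sm _] := partsP mu.
by apply: (sorted_eq (leT := geq)) pe => // [x y z|x y]; rewrite /geq /=; lia.
Qed.

(** Multiplicities determine the sorted list, so the bijections below can be checked by counting
    alone. *)
Lemma count_mem_partn_inj la mu :
  (forall i, 0 < i -> count_mem i la = count_mem i mu) -> la = mu.
Proof.
move=> H; apply/perm_partn_inj/allP => i; rewrite mem_cat.
by case/orP=> /partn_gt0 /H /= ->.
Qed.

Definition partn_nil : partn := @Partn [::] isT.

(* Zero entries are discarded. *)
Definition partn_of (s : seq nat) : partn :=
  insubd partn_nil (sort geq (filter (leq 1) s)).

Lemma perm_partn_of s : perm_eq (partn_of s) (filter (leq 1) s).
Proof.
rewrite /partn_of /= insubdK ?perm_sort // unfold_in /is_partn mem_sort mem_filter.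
by rewrite andbT; apply: sort_sorted => x y; rewrite /geq /=; lia.
Qed.

Definition partn_ins k p la : partn := partn_of (nseq k p ++ la).

Lemma perm_partn_ins k p la : 0 < p -> perm_eq (partn_ins k p la) (nseq k p ++ la).
Proof.
move=> p0; apply: perm_trans (perm_partn_of _) _.
rewrite (all_filterP _) // all_cat all_nseq p0 orbT /=.
by apply/allP => i /partn_gt0.
Qed.

Lemma count_partn_ins P k p la : 0 < p ->
  count P (partn_ins k p la) = P p * k + count P la.
Proof. by move=> /perm_partn_ins /permP ->; rewrite count_cat count_nseq. Qed.

Lemma sumn_partn_ins k p la : 0 < p -> sumn (partn_ins k p la) = p * k + sumn la.
Proof. by move=> /perm_partn_ins /perm_sumn ->; rewrite sumn_cat sumn_nseq. Qed.

Lemma partn_ins_inj k p : 0 < p -> injective (partn_ins k p).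
Proof.
move=> p0 la mu e; apply: count_mem_partn_inj => i _.
have := count_partn_ins (pred1 i) k la p0.
by rewrite e count_partn_ins // => /addnI.
Qed.

Lemma partn_ins_surj k p la : 0 < p -> k <= count_mem p la ->
  exists mu, partn_ins k p mu = la.
Proof.
move=> p0 kp.
(* All copies of [p] are dropped, then all but [k] of them are put back. *)
exists (partn_of (nseq (count_mem p la - k) p ++ filter (predC1 p) la)).
apply: count_mem_partn_inj => i i0; rewrite count_partn_ins //.
rewrite (permP (perm_partn_of _)) count_filter.
have -> : count (predI (pred1 i) (leq 1)) =1 count (pred1 i).
  by apply: eq_count => j /=; case: eqP => // ->; rewrite i0.
rewrite count_cat count_nseq count_filter /=; have [<-|pi] := eqVneq p i.
  rewrite (@eq_count _ (predI _ _) pred0) ?count_pred0.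
    by rewrite !mul1n addn0 subnKC.
  by move=> j /=; case: eqP.
rewrite !mul0n !add0n; apply: eq_count => j /=; case: eqP => // ->.
by rewrite eq_sym pi.
Qed.

Lemma sum_leq_nat M a : a <= M -> (\sum_(1 <= k < M.+1) (k <= a) = a)%N.
Proof.
move=> aM; rewrite (@big_cat_nat _ _ _ a.+1) //= big_nat.
rewrite (eq_bigr (fun=> 1)) => [|i /andP[_]]; last by rewrite ltnS => ->.
rewrite -big_nat sum_nat_const_nat [X in _ + X]big_nat big1; first by lia.
by move=> i /andP[ai _]; rewrite leqNgt ai.
Qed.

(* The k-th summand is the parity of the k-th part of the conjugate partition. *)
Lemma l_a_sum_odd la M : all (geq M) la ->
  l_a la = (\sum_(1 <= k < M.+1) odd (count (leq k) la))%N.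
Proof.
case: la => s ps; rewrite /l_a /=; case/andP: (ps) => + _ => {ps} ss sM.
suff -> : alt_sum s = (\sum_(1 <= k < M.+1) odd (count (leq k) s))%N%:Z by [].
elim: s ss sM => [|a s IHs].
  by move=> _ _; rewrite /alt_sum big_ord0 big1.
move=> /= pas /andP[aM sM].
have -> : alt_sum (a :: s) = (a%:Z - alt_sum s)%R.
  rewrite /alt_sum big_ord_recl expr0 mul1r -sumrN; congr (_ + _)%R.
  by apply: eq_bigr => i _; rewrite lift0 exprS mulN1r mulNr.
rewrite IHs ?(path_sorted pas) // -[in LHS](sum_leq_nat aM).
(* The largest part [a] raises the count by one for each [k <= a], so the old and new parities sum
   to 1; for [k > a] both counts are zero. *)
suff -> : (\sum_(1 <= k < M.+1) (k <= a) =
    \sum_(1 <= k < M.+1) odd ((k <= a) + count (leq k) s)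
    + \sum_(1 <= k < M.+1) odd (count (leq k) s))%N by lia.
rewrite -big_split; apply: eq_bigr => k _ /=.
have [ka|ak] := leqP k a; first by rewrite add1n /=; case: odd.
rewrite (@eq_in_count _ _ pred0) ?count_pred0 // => i si /=.
have /allP/(_ i si) /= : all (geq a) s.
  by apply: order_path_min pas => x y z; rewrite /geq /=; lia.
by lia.
Qed.

Lemma partn_le_sumn la i : i \in parts la -> i <= sumn la.
Proof. by elim: (parts la) => //= a s IHs; rewrite inE => /predU1P[->|/IHs]; lia. Qed.

Lemma size_le_sumn la : size la <= sumn la.
Proof.
have := @partn_gt0 la; elim: (parts la) => //= a s IHs H.
have := H a (mem_head _ _).
by have := IHs (fun i si => H i (mem_behead (s := a :: s) si)); lia.
Qed.

(** The first [p] columns of the Ferrers diagram grow by [k] each; for even [k] no parity in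
    [l_a_sum_odd] changes. *)
Lemma l_a_partn_ins k p la : 0 < p -> ~~ odd k -> l_a (partn_ins k p la) = l_a la.
Proof.
move=> p0 k_even.
have le_M : all (geq (p + sumn la)) la.
  by apply/allP => i /partn_le_sumn /=; lia.
rewrite (l_a_sum_odd le_M) (@l_a_sum_odd _ (p + sumn la)); last first.
  by rewrite (perm_all _ (perm_partn_ins k la p0)) all_cat all_nseq le_M /= leq_addr !orbT.
apply: eq_bigr => i _; rewrite count_partn_ins // oddD oddM.
by rewrite (negbTE k_even) andbF.
Qed.

Lemma l_o_partn_ins k p la : 0 < p -> l_o (partn_ins k p la) = odd p * k + l_o la.
Proof. by move=> p0; rewrite /l_o count_partn_ins. Qed.

(* The effect on Ferrers diagrams of prepending a column of length [r]. *)
Definition partn_col r la : partn :=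
  partn_of (map succn la ++ nseq (r - size la) 1).

Lemma perm_partn_col r la :
  perm_eq (partn_col r la) (map succn la ++ nseq (r - size la) 1).
Proof.
apply: perm_trans (perm_partn_of _) _.
by rewrite (all_filterP _) // all_cat all_nseq orbT andbT all_map; apply/allP.
Qed.

Lemma size_partn_col r la : size la <= r -> size (partn_col r la) = r.
Proof.
by move=> lr; rewrite (perm_size (perm_partn_col r la)) size_cat size_map size_nseq subnKC.
Qed.

Lemma sumn_partn_col r la : size la <= r -> sumn (partn_col r la) = r + sumn la.
Proof.
move=> lr; rewrite (perm_sumn (perm_partn_col r la)) sumn_cat sumn_nseq mul1n.
suff -> : sumn (map succn la) = size la + sumn la by lia.
by elim: (parts la) => //= a s ->; lia.
Qed.

(** The new column becomes the first part of the conjugate and shifts the others by one, so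
    [l_a_sum_odd] gains the summand [odd r]. *)
Lemma l_a_partn_col r la : size la <= r -> l_a (partn_col r la) = odd r + l_a la.
Proof.
move=> lr; pose M := sumn la.
have le_M : all (geq M) la by apply/allP => i /partn_le_sumn.
rewrite (l_a_sum_odd le_M) (@l_a_sum_odd _ M.+1); last first.
  rewrite (perm_all _ (perm_partn_col r la)) all_cat all_nseq orbT andbT all_map.
  exact: le_M.
rewrite big_nat_recl // ; congr (nat_of_bool (odd _) + _).
  rewrite -[RHS](size_partn_col lr) -(count_predT (partn_col r la)).
  by apply: eq_in_count => i /partn_gt0.
apply: eq_big_nat => i /andP[i0 _]; rewrite (permP (perm_partn_col r la)).
by rewrite count_cat count_nseq count_map /= ltnS leqn0 -(prednK i0) addn0.
Qed.

(** The padding consists of ones only, so the multiplicity of each [i > 0] can be read off at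
    [i.+1]. *)
Lemma partn_col_inj r : injective (partn_col r).
Proof.
move=> la mu e; apply: count_mem_partn_inj => i i0.
have H (nu : partn) : count_mem i nu = count_mem i.+1 (partn_col r nu).
  rewrite (permP (perm_partn_col r nu)) count_cat count_nseq count_map /=.
  by rewrite eqSS eq_sym (gtn_eqF i0) addn0.
by rewrite !H e.
Qed.

(** The preimage removes the first column: every part drops by one, and the resulting zeros are
    discarded by [partn_of]. *)
Lemma partn_col_surj r la : size la = r ->
  exists2 mu : partn, size mu <= r & partn_col r mu = la.
Proof.
move=> lr; pose mu := partn_of (map predn la).
have pmu : perm_eq mu (map predn (filter (leq 2) la)).
  apply: perm_trans (perm_partn_of _) _; rewrite filter_map.
  by rewrite (@eq_filter _ _ (leq 2)) // => -[|[]].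
have smu : size mu = count (leq 2) la.
  by rewrite (perm_size pmu) size_map size_filter.
exists mu; first by rewrite smu -lr count_size.
apply: count_mem_partn_inj => i i0.
rewrite (permP (perm_partn_col r mu)) count_cat count_nseq smu -lr.
rewrite (permP (perm_map succn pmu)) -map_comp map_id_in; last first.
  by move=> j; rewrite mem_filter => /andP[j2 _] /=; rewrite prednK //; lia.
rewrite count_filter -(count_predC (leq 2)) addKn.
(* For [i = 1] only the padding counts, and it restores the discarded ones; for larger [i] only the
   incremented parts count. *)
case: i i0 => // -[|i] _ /=.
  rewrite (@eq_count _ _ pred0) ?count_pred0; last by case=> [|[]].
  rewrite mul1n; apply: eq_in_count => j /partn_gt0.
  by case: j => [|[]].
rewrite mul0n addn0; apply: eq_count => j /=; case: eqP => // ->; lia.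
Qed.

End Partitions.

(** * Generating functions and their product formulas *)

Section GeneratingFunction.
Set Implicit Arguments.
Unset Strict Implicit.
Local Notation partn := Defs.partn.
Local Open Scope classical_set_scope.
Variables (R : comNzRingType) (c : R).
Implicit Types (la mu : partn) (S : set partn) (stat : partn -> nat).

Definition partn_gf stat S : fps R :=
  fps_sum S (fun la => fpsC c ^+ stat la * fpsX ^+ sumn la).

Lemma fcoef_partn_gf stat S n : fcoef (partn_gf stat S) n =
  \sum_(la \in S `&` [set la | sumn la = n]) c ^+ stat la.
Proof.
rewrite fsbig_mkcondr; apply: eq_fsbigr => la _; rewrite fcoef_monomial.
by rewrite eq_sym; congr (if _ then _ else _); apply/eqP/idP; rewrite inE.
Qed.

Lemma finite_partn_ofI S n : finite_set (S `&` [set la | sumn la = n]).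
Proof. by apply: sub_finite_set (finite_partn_of n) => la []. Qed.

(** Outside [S'], the set [S] is a copy of itself with weights multiplied by [c^a q^b]. Hence G(S) =
    G(S') + c^a q^b G(S), which is solved for G(S'). *)
Lemma partn_gf_peel stat S S' (phi : partn -> partn) a b :
    S' `<=` S -> set_bij S (S `\` S') phi ->
    (forall la, S la -> stat (phi la) = (a + stat la)%N) ->
    (forall la, S la -> sumn (phi la) = (b + sumn la)%N) ->
  partn_gf stat S' = partn_gf stat S * (1 - fpsC c ^+ a * fpsX ^+ b).
Proof.
move=> S'S [phiS phi_inj phi_surj] statphi sumphi.
suff E : partn_gf stat S =
    partn_gf stat S' + fpsC c ^+ a * fpsX ^+ b * partn_gf stat S.
  by rewrite mulrBr mulr1 [X in _ - X]mulrC {1}E addrK.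
apply: fpsP => n; rewrite fcoefD fpsC_exp -mulrA fcoef_fpsCM fcoef_fpsXnM.
rewrite !fcoef_partn_gf (fsbigID S') /=; last exact: finite_partn_ofI.
congr (_ + _).
  by apply: eq_fsbigl; apply/seteqP; split=> la [] => [[]|/[dup] /S'S].
(* Images under [phi] have size at least [b], so for [n < b] no partition of [n] lies in [S] outside
   [S']. *)
have [bn|nb] := leqP b n; last first.
  rewrite mulr0 fsbig1 // => la [[/= Sla lan] nS'la].
  by have [mu /sumphi mub phimu] := phi_surj la (conj Sla nS'la);
     rewrite -lan -phimu mub ltnNge leq_addr in nb.
rewrite (fsbig_distrr (zero := 0)) /=; last exact: finite_partn_ofI.
rewrite (reindex_fsbig phi (S `&` [set la | sumn la = n - b]%N)).
  by apply: eq_fsbigr => la /[!inE] -[/statphi -> _]; rewrite exprD.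
split.
- move=> la [/= Sla lan]; have [Sphi nS'] := phiS la Sla.
  by do !split=> //=; rewrite sumphi // lan subnKC.
- by move=> la mu /[!inE] -[Sla _] [Smu _]; apply: phi_inj; rewrite inE.
- move=> la [[/= Sla lan] nS'la].
  have [mu Smu phimu] := phi_surj la (conj Sla nS'la).
  by exists mu => //; split=> //=; rewrite -lan -phimu sumphi // addKn.
Qed.

(** The coefficient of [q^k] sees only partitions of [k], on which [S_ N] and [S] agree once
    [k <= N]. *)
Lemma is_fps_lim_partn_gf stat (S_ : nat -> set partn) S :
    (forall N la, (sumn la <= N)%N -> S_ N la <-> S la) ->
  is_fps_lim (fun N => partn_gf stat (S_ N)) (partn_gf stat S).
Proof.
move=> S_S k; exists k => N kN; rewrite !fcoef_partn_gf.
by apply: eq_fsbigl; apply/seteqP; split=> la [/= + lak];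
   (have /S_S H : (sumn la <= N)%N by rewrite lak) => /H.
Qed.

Lemma partn_gf_nil stat : stat partn_nil = 0%N -> partn_gf stat [set partn_nil] = 1.
Proof.
move=> stat0; apply: fpsP => n.
have -> : fcoef (partn_gf stat [set partn_nil]) n =
    fcoef (fpsC c ^+ stat partn_nil * fpsX ^+ sumn partn_nil) n.
  exact: fsbig_set1.
by rewrite fcoef_monomial stat0 expr0 fcoef1; case: eqP.
Qed.

Definition euler_prod n : fps R :=
  \prod_(i < n) (1 - fpsC c ^+ odd i.+1 * fpsX ^+ i.+1).

(** By induction, each stage of the filtration is peeled down to the previous one, at the cost of
    one Euler factor. *)
Lemma partn_gf_euler stat (S_ : nat -> set partn) (phi : nat -> partn -> partn) :
    stat partn_nil = 0%N -> S_ 0%N = [set partn_nil] ->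
    (forall r, S_ r `<=` S_ r.+1) ->
    (forall r, set_bij (S_ r.+1) (S_ r.+1 `\` S_ r) (phi r.+1)) ->
    (forall r la, S_ r.+1 la -> stat (phi r.+1 la) = odd r.+1 + stat la)%N ->
    (forall r la, S_ r.+1 la -> sumn (phi r.+1 la) = r.+1 + sumn la)%N ->
  forall r, partn_gf stat (S_ r) * euler_prod r = 1.
Proof.
move=> stat0 S0 Ssub phi_bij statphi sumphi; elim=> [|r IHr].
  by rewrite S0 partn_gf_nil // /euler_prod big_ord0 mulr1.
rewrite /euler_prod big_ord_recr /= [X in _ * X]mulrC mulrA -[RHS]IHr.
congr (_ * _); apply/esym.
exact: (partn_gf_peel (@Ssub r) (phi_bij r) (statphi r) (sumphi r)).
Qed.

(** The equivalence makes [S] stable under both inserting and deleting [k] copies of [p]. *)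
Lemma set_bij_partn_ins k p S : (0 < p)%N ->
    (forall la, S (partn_ins k p la) <-> S la) ->
  set_bij S (S `&` [set la | (k <= count_mem p la)%N]) (partn_ins k p).
Proof.
move=> p0 S_ins; split.
- move=> la Sla; split; first exact/S_ins.
  by rewrite /= count_partn_ins //= eqxx mul1n leq_addr.
- by move=> la mu _ _ /partn_ins_inj; apply.
- move=> la [Sla /= /(partn_ins_surj p0) [mu E]].
  by exists mu => //; apply/S_ins; rewrite E.
Qed.

(** Filtration by largest part: a partition new at stage [r.+1] contains the part [r.+1], and one
    copy of it can be removed. *)
Lemma partn_gf_l_o_le r :
  partn_gf l_o [set la | all (geq r) la] * euler_prod r = 1.
Proof.
pose S r := [set la : partn | all (geq r) la].
apply: (partn_gf_euler (S_ := S) (phi := partn_ins 1)) => {r} //.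
- apply/seteqP; split=> [la /= /allP la0|_ ->] //; apply: count_mem_partn_inj => i i0.
  by apply/eqP; rewrite /= -leqn0 leqNgt -has_count has_pred1;
     apply/negP => /la0 /=; lia.
- by move=> r la /=; apply: sub_all => i /=; lia.
- move=> r.
  have -> : S r.+1 `\` S r = S r.+1 `&` [set la | (1 <= count_mem r.+1 la)%N].
    apply/seteqP; split=> la [/= /allP Sla] H; split; try exact/allP.
      rewrite /= -has_count has_pred1; apply: contra_notT H => rla.
      apply/allP => i ila /=; have := Sla i ila => /=; rewrite leq_eqVlt.
      by case/predU1P => [E|]; [rewrite -E ila in rla | rewrite ltnS].
    move=> /allP /(_ r.+1); rewrite -has_pred1 has_count => /(_ H) /=; lia.
  apply: set_bij_partn_ins => // la; rewrite /S /=.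
  by rewrite (perm_all _ (perm_partn_ins 1 la (ltn0Sn r))) /= leqnn.
- by move=> r la _; rewrite l_o_partn_ins // muln1.
- by move=> r la _; rewrite sumn_partn_ins // muln1.
Qed.

(** Filtration by number of parts: a partition new at stage [r.+1] has a first column of length
    exactly [r.+1]. *)
Lemma partn_gf_l_a_size r :
  partn_gf l_a [set la | (size la <= r)%N] * euler_prod r = 1.
Proof.
apply: (partn_gf_euler (S_ := fun r => [set la | (size la <= r)%N])
  (phi := partn_col)) => {r}.
- by rewrite /l_a /alt_sum big_ord0.
- apply/seteqP; split=> [la /=|_ ->] //; rewrite leqn0 => /eqP /size0nil la0.
  exact: val_inj.
- by move=> r la /= /leqW.
- move=> r; split.
  + by move=> la /= Sla; rewrite size_partn_col // ltnn.
  + by move=> la mu _ _ /partn_col_inj.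
  + move=> la [/= le_r /negP]; rewrite -ltnNge => lt_r.
    have [|mu mur E] := @partn_col_surj r.+1 la; first by apply/eqP; rewrite eqn_leq le_r.
    by exists mu.
- by move=> r la /l_a_partn_col.
- by move=> r la /sumn_partn_col.
Qed.

Lemma is_fps_lim_l_o_le :
  is_fps_lim (fun r => partn_gf l_o [set la | all (geq r) la]) (partn_gf l_o setT).
Proof.
apply: is_fps_lim_partn_gf => r la lar; split=> // _ /=.
by apply/allP => i /partn_le_sumn /=; lia.
Qed.

Lemma partn_gf_l_a_l_o : partn_gf l_a setT = partn_gf l_o setT.
Proof.
have lim_a : is_fps_lim (fun r => partn_gf l_a [set la | (size la <= r)%N])
    (partn_gf l_a setT).
  apply: is_fps_lim_partn_gf => r la lar; split=> // _ /=.
  exact: leq_trans (size_le_sumn la) lar.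
apply: is_fps_lim_unique lim_a _ => k; have [N HN] := is_fps_lim_l_o_le k.
exists N => r /HN <-; congr (fcoef _ k).
(* Both truncations are inverse to [euler_prod r], hence equal. *)
by rewrite -[LHS]mulr1 -(partn_gf_l_o_le r) mulrCA partn_gf_l_a_size mulr1.
Qed.

(* Successively remove, for i = 1, 2, ..., the partitions with at least [k]
   parts [d * i]; inserting [k] such parts is a bijection onto them. *)
Lemma partn_gf_bounded_mult stat k d : (0 < k)%N -> (0 < d)%N ->
    (forall i la, (0 < i)%N -> stat (partn_ins k (d * i) la) = stat la) ->
  partn_gf stat [set la | forall i, (0 < i)%N -> (count_mem (d * i)%N la < k)%N]
    = partn_gf stat setT * qpoch (fpsX ^+ (k * d)) (fpsX ^+ (k * d)).
Proof.
move=> k0 d0 stat_ins.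
pose V N : set partn := [set la | forall i, (0 < i <= N)%N -> (count_mem (d * i)%N la < k)%N].
have gfV N : partn_gf stat (V N) = partn_gf stat setT *
    \prod_(i < N) (1 - fpsX ^+ (k * d) * (fpsX ^+ (k * d)) ^+ i).
  elim: N => [|N IHN].
    rewrite big_ord0 mulr1; congr (partn_gf _ _); apply/seteqP; split=> // la _ i.
    by rewrite -ltnS; lia.
  (* The new factor is put in the form [1 - c^0 q^b] required by [partn_gf_peel]; the exponent is 0
     because [stat] is unchanged. *)
  rewrite big_ord_recr /= mulrA -IHN -exprM -exprD -[X in 1 - X]mul1r.
  rewrite -[1 in X in 1 - X](expr0 (fpsC c)) -mulnS -mulnA.
  have p0 : (0 < d * N.+1)%N by rewrite muln_gt0 d0.
  have sub : V N.+1 `<=` V N by move=> la Vla i iN; apply: Vla; lia.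
  apply: (partn_gf_peel (phi := partn_ins k (d * N.+1))) => // [|la _|la _].
  - have -> : V N `\` V N.+1 = V N `&` [set la | (k <= count_mem (d * N.+1) la)%N].
      apply/seteqP; split=> la [/= Vla H]; split=> //.
        rewrite /= leqNgt; apply: contra_notN H => H i /andP[i0].
        by rewrite leq_eqVlt => /predU1P[-> //|iN]; apply: Vla; rewrite i0.
      by move=> /(_ N.+1); rewrite leqnn => /(_ isT); rewrite ltnNge H.
    (* Inserting [d * N.+1] leaves the multiplicities of [d * i] with [i <= N] alone. *)
    apply: set_bij_partn_ins => // la.
    by split=> Vla i iN; move: (Vla i iN); rewrite count_partn_ins //=;
       rewrite eqn_pmul2l // gtn_eqF //; lia.
  - by rewrite stat_ins.
  - by rewrite sumn_partn_ins // mulnC.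
have limV : is_fps_lim (fun N => partn_gf stat (V N)) (partn_gf stat
    [set la | forall i, (0 < i)%N -> (count_mem (d * i)%N la < k)%N]).
  apply: is_fps_lim_partn_gf => N la laN; split=> Vla i; last by case/andP=> /Vla.
  (* For [i > N] the number [d * i] exceeds the size of the partition, so it cannot be a part. *)
  move=> i0; have [iN|Ni] := leqP i N; first by apply: Vla; rewrite i0.
  suff /count_memPn -> : (d * i)%N \notin parts la by [].
  by apply/negP => /partn_le_sumn; nia.
apply: is_fps_lim_unique limV _.
under eq_fun do rewrite gfV.
apply: is_fps_limM; first exact: is_fps_lim_cst.
by apply/qpoch_cvg/fcoef_fpsXn0; rewrite muln_gt0 k0.
Qed.

(** Truncating the Euler product at [n.*2] pairs its factors, which reduces the claim to an identity
    of finite products. *)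
Lemma partn_gf_l_o_product :
  partn_gf l_o setT
    * (qpoch (fpsX ^+ 2) (fpsX ^+ 2) * qpoch (fpsC c ^+ 2 * fpsX ^+ 2) (fpsX ^+ 4))
  = qpoch (- (fpsC c * fpsX)) (fpsX ^+ 2).
Proof.
have lim_l := is_fps_limM (is_fps_lim_double is_fps_lim_l_o_le)
  (is_fps_limM (qpoch_cvg (fpsX ^+ 2) (fcoef_fpsXn0 R (b := 2) isT))
     (qpoch_cvg (fpsC c ^+ 2 * fpsX ^+ 2) (fcoef_fpsXn0 R (b := 4) isT))).
have lim_r := qpoch_cvg (- (fpsC c * fpsX)) (fcoef_fpsXn0 R (b := 2) isT).
apply: is_fps_lim_unique lim_l _ => k; have [N HN] := lim_r k; exists N => n /HN <-.
congr (fcoef _ k).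
suff -> : \prod_(i < n) (1 - fpsX ^+ 2 * (fpsX ^+ 2) ^+ i)
    * \prod_(i < n) (1 - fpsC c ^+ 2 * fpsX ^+ 2 * (fpsX ^+ 4) ^+ i)
    = euler_prod n.*2 * \prod_(i < n) (1 - - (fpsC c * fpsX) * (fpsX ^+ 2) ^+ i).
  by rewrite mulrA partn_gf_l_o_le mul1r.
elim: n => [|n IHn]; first by rewrite /euler_prod !big_ord0.
rewrite /euler_prod doubleS !big_ord_recr /= -/(euler_prod _).
rewrite odd_double /= expr1 expr0 mul1r mulrACA IHn.
have -> : (fpsX : fps R) ^+ n.*2.+2 = fpsX ^+ 2 * (fpsX ^+ 2) ^+ n.
  by rewrite -exprM mul2n -exprD.
have -> : (fpsX : fps R) ^+ n.*2.+1 = fpsX * (fpsX ^+ 2) ^+ n.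
  by rewrite -exprM mul2n -exprS.
have -> : ((fpsX : fps R) ^+ 4) ^+ n = (fpsX ^+ 2) ^+ n * (fpsX ^+ 2) ^+ n.
  by rewrite -exprMn -exprD.
(* With [y = q^(2n)], this is the difference of squares 1 - x^2 q^2 y^2 = (1 - xqy)(1 + xqy). *)
move: (euler_prod _) (\prod_(i < n) _) ((fpsX ^+ 2) ^+ n) => P Q y; ring.
Qed.

End GeneratingFunction.

(** * Bounded multiplicities and the final product *)

Theorem theorem3p3 (m : nat) :
  let x : fps {poly int} := fpsC 'X in
  let q : fps {poly int} := fpsX in
  fps_sum (A_ m) (fun la => x ^+ l_a la * q ^+ sumn (parts la))
    = fps_sum (B_ m) (fun mu => x ^+ l_o mu * q ^+ sumn (parts mu))
  /\
  fps_sum (B_ m) (fun mu => x ^+ l_o mu * q ^+ sumn (parts mu))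
    = (qpoch (- (x * q)) (q ^+ 2)
         * qpoch (q ^+ (2 * m + 2)) (q ^+ (2 * m + 2)))
      / (qpoch (q ^+ 2) (q ^+ 2) * qpoch (x ^+ 2 * q ^+ 2) (q ^+ 4)).
Proof.
move=> x q.
rewrite -/(partn_gf 'X l_a (A_ m)) -/(partn_gf 'X l_o (B_ m)).
have gfA : partn_gf 'X l_a (A_ m) =
    partn_gf 'X l_o setT * qpoch (q ^+ (2 * m + 2)) (q ^+ (2 * m + 2)).
  rewrite -partn_gf_l_a_l_o.
  (* The case [d = 1], [k = 2 * m + 2]; the bound at [i = 0] is automatic, since 0 is never a
     part. *)
  have -> : A_ m = [set la | forall i, (0 < i)%N ->
      (count_mem (1 * i)%N (parts la) < 2 * m + 2)%N]%classic.
    apply/seteqP; split=> la /= H => [i _|[|i]]; first by rewrite mul1n addnS ltnS.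
      by have /andP[_ /count_memPn ->] := partsP la.
    by have := H i.+1 isT; rewrite mul1n addnS ltnS.
  rewrite partn_gf_bounded_mult ?muln1 //; first by lia.
  by move=> i la i0; rewrite l_a_partn_ins ?muln_gt0 // oddD oddM.
have gfB : partn_gf 'X l_o (B_ m) =
    partn_gf 'X l_o setT * qpoch (q ^+ (2 * m + 2)) (q ^+ (2 * m + 2)).
  (* The case [d = 2], [k = m.+1]: the even parts are the multiples of 2. *)
  have -> : B_ m = [set la | forall i, (0 < i)%N ->
      (count_mem (2 * i)%N (parts la) < m.+1)%N]%classic.
    apply/seteqP; split=> la /= H i.
      by move=> _; rewrite ltnS; apply: H; rewrite oddM.
    move=> /even_halfK <-; rewrite -mul2n; case: (i./2) => [|j]; last exact: H.
    by have /andP[_ /count_memPn ->] := partsP la.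
  have -> : (2 * m + 2 = m.+1 * 2)%N by lia.
  apply: partn_gf_bounded_mult => //.
  by move=> i la i0; rewrite l_o_partn_ins ?muln_gt0 // oddM.
split; first by rewrite gfA gfB.
apply/(canRL (mulrK _)).
  rewrite unitrM; apply/andP; split; apply: qpoch_unit; try exact: fcoef_fpsXn0.
  by rewrite fcoefM big_ord1 [fcoef (q ^+ 2) _]fcoef_fpsXn0 ?mulr0.
by rewrite gfB mulrAC partn_gf_l_o_product.
Qed.
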